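(* Let $\mu$ be a probability measure on $\mathbb{R}^d$ that is absolutely continuous with respect to Lebesgue measure, let $t>0$, and let $\eta$ be a Poisson point process on $\mathbb{R}^d$ with intensity measure $t\mu$. Let $\Pi_t$ be the convex hull of the points of $\eta$, and let $I(\Pi_t)$ be the number of points of $\eta$ lying in the interior of $\Pi_t$. Then for every $k\in\mathbb{N}$, $$\mathbb{E}\, I(\Pi_t)_{(k)}=t^k\,\mathbb{E}\,\mu(\Pi_t)^k,$$ where $n_{(k)}=n(n-1)\cdots(n-k+1)$ denotes the falling factorial.
   Context: A Poisson point process $\eta$ with intensity measure $t\mu$ is a random finite simple counting measure such that $\eta(A)$ is Poisson distributed with parameter $t\mu(A)$ for every Borel set $A$ and $\eta(A_1),\dots,\eta(A_m)$ are independent for pairwise disjoint Borel sets. *)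

(* Defs.v *)
From HB Require Import structures.
From mathcomp Require Import all_boot all_order all_algebra finmap.
From mathcomp Require Import all_classical all_reals all_analysis.

Set Implicit Arguments.
Unset Strict Implicit.
Unset Printing Implicit Defensive.

Import Order.TTheory GRing.Theory Num.Theory.
Import numFieldTopology.Exports numFieldNormedType.Exports.

Local Open Scope classical_set_scope.
Local Open Scope ring_scope.

(* R^d is 'rV[R]_d (with its canonical product/sup-norm topology, which is the
   Euclidean topology).  Borel sets of R^d = sigma-algebra generated by the
   open sets. *)
Notation borelRd R d := (g_sigma_algebraType (@open 'rV[R]_d)).

Definition box (R : realType) (d : nat) (a b : 'rV[R]_d) : set 'rV[R]_d :=
  [set x | forall i : 'I_d, a ord0 i <= x ord0 i <= b ord0 i].

Definition box_vol (R : realType) (d : nat) (a b : 'rV[R]_d) : R :=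
  \prod_(i < d) Num.max (b ord0 i - a ord0 i) 0.

Definition lebesgue_null (R : realType) (d : nat) (N : set 'rV[R]_d) : Prop :=
  forall e : R, 0 < e ->
    exists a b : nat -> 'rV[R]_d,
      N `<=` \bigcup_n box (a n) (b n) /\
      (\sum_(0 <= n <oo) (box_vol (a n) (b n))%:E < e%:E)%E.

Definition abs_cont_lebesgue (R : realType) (d : nat)
  (mu : set (borelRd R d) -> \bar R) : Prop :=
  forall A : set (borelRd R d), measurable A -> lebesgue_null A -> mu A = 0%E.

(* Poisson distribution with parameter lam >= 0 (Poisson(0) = Dirac at 0) *)
Definition poisson_mass (R : realType) (lam : R) (n : nat) : R :=
  expR (- lam) * lam ^+ n / (n`!)%:R.

Definition count_in (R : realType) (d : nat) (S : {fset 'rV[R]_d})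
  (A : set 'rV[R]_d) : nat :=
  #|` [fset x in S | x \in A]%fset |.

(* A Poisson point process with intensity measure lam, modelled as a random
   finite simple counting measure, i.e. a random finite set of points
   eta : Omega -> {fset R^d}:
   - eta(A) is a random variable for every Borel A,
   - eta(A) ~ Poisson(lam(A)),
   - eta(A_1), ..., eta(A_m) are (mutually) independent for pairwise disjoint
     Borel A_1, ..., A_m. *)
Definition poisson_point_process (R : realType) (d : nat)
  (dO : measure_display) (Omega : measurableType dO) (P : probability Omega R)
  (lam : set (borelRd R d) -> \bar R) (eta : Omega -> {fset 'rV[R]_d}) : Prop :=
  [/\ (forall A : set (borelRd R d), measurable A ->
         measurable_fun setT (fun w => count_in (eta w) A)),
      (forall A : set (borelRd R d), measurable A ->
         lam A \is a fin_num /\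
         forall n : nat,
           P [set w | count_in (eta w) A = n] = (poisson_mass (fine (lam A)) n)%:E) &
      (forall (m : nat) (A : 'I_m -> set (borelRd R d)),
         (forall i, measurable (A i)) ->
         (forall i j, i != j -> A i `&` A j = set0) ->
         forall B : 'I_m -> set nat,
           P (\bigcap_(i in [set: 'I_m]) [set w | B i (count_in (eta w) (A i))]) =
           (\prod_(i < m) P [set w | B i (count_in (eta w) (A i))])%E)].

Definition conv_hull (R : realType) (d : nat) (S : {fset 'rV[R]_d}) : set 'rV[R]_d :=
  [set x | exists w : 'rV[R]_d -> R,
     [/\ forall p, p \in S -> 0 <= w p,
         \sum_(p <- S) w p = 1 &
         x = \sum_(p <- S) w p *: p]].

Definition interior_count (R : realType) (d : nat) (S : {fset 'rV[R]_d}) : nat :=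
  count_in S (interior (conv_hull S)).

(* Main.v *)
(** Let V be a deterministic region and E an event that depends on the process
outside V only. Then the number of points in V is Poisson with parameter
t mu(V) and independent of E, so on E its k-th factorial moment is
P(E) t^k mu(V)^k. The interior of the hull has this structure, since points
lying in the interior of the hull do not contribute to it.

To avoid conditioning on point configurations, R^d is cut into finitely many
cells, and the interior of the hull is replaced by the union of the cells that
are certain to lie inside it, given which cells are occupied. This set of cells
is determined by the occupied cells outside it (the core), which gives a finite
partition into events as above. Refining the cells exhausts the interior of the
hull, and monotone convergence gives the moment identity for the interior.
Finally the boundary of a convex set is Lebesgue null: when a cube is subdivided
into 5^d cubes, one of them always misses the boundary. *)

Require Import Defs.
From HB Require Import structures.
From mathcomp Require Import all_boot all_order all_algebra finmap.
From mathcomp Require Import all_classical all_reals all_analysis.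
From mathcomp Require Import measurable_realfun.
From mathcomp Require Import ring lra.

Set Implicit Arguments.
Unset Strict Implicit.
Unset Printing Implicit Defensive.

Import Order.TTheory GRing.Theory Num.Theory.
Import numFieldTopology.Exports numFieldNormedType.Exports.
Local Open Scope classical_set_scope.
Local Open Scope ring_scope.

(** * Convex hulls of finite sets *)

Definition convex_stable (R : realType) (d : nat) (K : set 'rV[R]_d) : Prop :=
  forall x y a, K x -> K y -> 0 <= a -> a <= 1 -> K (a *: x + (1 - a) *: y).

Lemma convex_comb_gt0 (R : realFieldType) (a u v : R) :
  0 <= a -> a <= 1 -> 0 < u -> 0 < v -> 0 < a * u + (1 - a) * v.
Proof.
move=> a0 a1 u0 v0; have [->|an0] := eqVneq a 0; first lra.
by apply: ltr_wpDr; rewrite ?mulr_ge0 ?subr_ge0 ?(ltW v0)// mulr_gt0// lt0r an0.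
Qed.

Lemma rV_ballP (R : realType) (d : nat) (x y : 'rV[R]_d) (e : R) : 0 < e ->
  ball x e y <-> forall i, `|x ord0 i - y ord0 i| < e.
Proof.
move=> e0; split=> [[_ xy] i|xy].
  by have := xy ord0 i; rewrite -ball_normE.
split=> // i j; rewrite (ord1 i) -ball_normE; exact: xy.
Qed.

Lemma conv_hull_convex (R : realType) (d : nat) (S : {fset 'rV[R]_d}) :
  convex_stable (conv_hull S).
Proof.
move=> x y a [u [u0 u1 ->]] [v [v0 v1 ->]] a0 a1.
exists (fun p => a * u p + (1 - a) * v p); split.
- by move=> p pS; rewrite addr_ge0 ?mulr_ge0 ?u0 ?v0 ?subr_ge0.
- by rewrite big_split/= -!mulr_sumr u1 v1; lra.
- rewrite !scaler_sumr -big_split/=; apply: eq_bigr => p _.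
  by rewrite !scalerA -scalerDl.
Qed.

Lemma conv_hull0 (R : realType) (d : nat) :
  conv_hull (fset0 : {fset 'rV[R]_d}) = set0.
Proof.
rewrite -subset0 => x [w [_ + _]]; rewrite big_seq_fset0 => /eqP.
by rewrite eq_sym oner_eq0.
Qed.

(** Inductive step for hulls: split off the weight at [x] and renormalise the others, unless that
    weight is 1 and they all vanish. The strict bound on [a] lets [conv_hull_D1] divide by
    [1 - a]. *)
Lemma conv_hull_cons (R : realType) (d : nat) (x : 'rV[R]_d)
    (S : {fset 'rV[R]_d}) (y : 'rV[R]_d) : x \notin S ->
  conv_hull (x |` S)%fset y ->
  y = x \/ exists a u, [/\ 0 <= a, a < 1, conv_hull S u &
                          y = a *: x + (1 - a) *: u].
Proof.
move=> xS [w [w0]]; rewrite !(big_fsetU1 _ _ xS)/= => w1 yE.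
have wS0 p : p \in S -> 0 <= w p by move=> pS; rewrite w0// fset1Ur.
have wx0 : 0 <= w x by rewrite w0// fset1U1.
have s0 : 0 <= \sum_(p <- S) w p by rewrite big_seq sumr_ge0.
have [wx1|wx1] := eqVneq (w x) 1.
  left; rewrite yE wx1 scale1r big_seq big1 ?addr0// => p pS.
  have sw0 : \sum_(p <- S) w p = 0 by move: w1; rewrite wx1; lra.
  have : \sum_(p <- S | p \in S) w p == 0 by rewrite -big_seq sw0.
  rewrite psumr_eq0// => /allP/(_ p pS); rewrite pS/= => /eqP ->.
  by rewrite scale0r.
have wx_lt1 : w x < 1 by rewrite lt_neqAle wx1/=; lra.
right; exists (w x), ((1 - w x)^-1 *: \sum_(p <- S) w p *: p); split => //.
  exists (fun p => (1 - w x)^-1 * w p); split.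
  - by move=> p pS; rewrite mulr_ge0 ?wS0// invr_ge0 subr_ge0 ltW.
  - rewrite -mulr_sumr (_ : \sum_(p <- S) w p = 1 - w x); last by lra.
    by rewrite mulVf// subr_eq0 eq_sym.
  - by rewrite scaler_sumr; apply: eq_bigr => p _; rewrite scalerA.
by rewrite yE scalerA divff ?scale1r// subr_eq0 eq_sym.
Qed.

Lemma conv_hull_self (R : realType) (d : nat) (S : {fset 'rV[R]_d})
  (x : 'rV[R]_d) : x \in S -> conv_hull S x.
Proof.
move=> xS; exists (fun p => (p == x)%:R); split.
- by move=> p _; rewrite ler0n.
- rewrite (bigD1_seq x xS (fset_uniq S))/= eqxx big1 ?addr0// => p /negbTE ->//.
- rewrite (bigD1_seq x xS (fset_uniq S))/= eqxx scale1r big1 ?addr0// => p /negbTE ->.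
  by rewrite scale0r.
Qed.

Lemma conv_hull_min (R : realType) (d : nat) (S : {fset 'rV[R]_d})
    (K : set 'rV[R]_d) :
  convex_stable K -> (forall p, p \in S -> K p) -> conv_hull S `<=` K.
Proof.
move=> cK; elim/fset1U_rect: S => [_|x S xS IH SK]; first by rewrite conv_hull0.
have {}IH : conv_hull S `<=` K by apply: IH => p pS; apply: SK; rewrite fset1Ur.
have Kx : K x by apply: SK; rewrite fset1U1.
move=> y /(conv_hull_cons xS)[->//|[a [u [a0 a1 Su ->]]]].
by apply: cK => //; [exact: IH|exact: ltW].
Qed.

Lemma conv_hull_mono (R : realType) (d : nat) (S T : {fset 'rV[R]_d}) :
  {subset S <= T} -> conv_hull S `<=` conv_hull T.
Proof.
move=> ST; apply: conv_hull_min => [|p /ST]; first exact: conv_hull_convex.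
exact: conv_hull_self.
Qed.

(** The points that are coordinatewise [e]-close to [conv_hull T] form a convex set containing [S],
    so [conv_hull_min] applies. *)
Lemma conv_hull_perturb (R : realType) (d : nat) (S T : {fset 'rV[R]_d})
    (e : R) :
  (forall p, p \in S -> exists2 q, q \in T &
     forall i, `|p ord0 i - q ord0 i| < e) ->
  forall x, conv_hull S x -> exists2 y, conv_hull T y &
     forall i, `|x ord0 i - y ord0 i| < e.
Proof.
move=> ST; apply: (conv_hull_min (K := fun x => exists2 y, conv_hull T y &
     forall i, `|x ord0 i - y ord0 i| < e)) => [|p /ST[q qT pq]]; last first.
  by exists q => //; exact: conv_hull_self.
move=> x x' a [y Ty xy] [y' Ty' xy'] a0 a1.
exists (a *: y + (1 - a) *: y'); first exact: conv_hull_convex.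
move=> i; rewrite !mxE; have /ltr_normlP[h1 h2] := xy i.
have /ltr_normlP[h3 h4] := xy' i.
rewrite ltr_norml; apply/andP; split.
  have := @convex_comb_gt0 _ a (e + (x ord0 i - y ord0 i))
    (e + (x' ord0 i - y' ord0 i)) a0 a1; lra.
have := @convex_comb_gt0 _ a (e - (x ord0 i - y ord0 i))
  (e - (x' ord0 i - y' ord0 i)) a0 a1; lra.
Qed.

(* Two points of K that agree in the first j coordinates and lie on
   either side of y in coordinate j are joined by a segment that crosses the
   hyperplane of points with the j-th coordinate of y. *)
Lemma convex_stable_orthants (R : realType) (d : nat) (K : set 'rV[R]_d)
    (y : 'rV[R]_d) : convex_stable K ->
  (forall s : 'I_d -> bool, exists2 v, K v &
     forall i, 0 < (-1) ^+ s i * (v ord0 i - y ord0 i)) ->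
  K y.
Proof.
move=> cK Kv.
suff H (j : nat) : (j <= d)%N -> forall s : 'I_d -> bool, exists2 v, K v &
    forall i : 'I_d, if (i < j)%N then v ord0 i = y ord0 i
             else 0 < (-1) ^+ s i * (v ord0 i - y ord0 i).
  have [v Kv' vy] := H d (leqnn d) (fun=> false).
  suff <- : v = y by [].
  by apply/rowP => i; have := vy i; rewrite ltn_ord.
elim: j => [_ s|j IH jd s]; first by have [v] := Kv s; exists v.
have ij : (j < d)%N by [].
pose J := Ordinal ij.
(* Only the sign at [J] is overwritten: there [v1] lies above and [v2] below [y], while in the later
   coordinates both follow [s]. The weight [a] is the one that hits the value of [y] at [J]. *)
have [v1 K1 h1] := IH (ltnW jd) (fun i => if i == J then false else s i).
have [v2 K2 h2] := IH (ltnW jd) (fun i => if i == J then true else s i).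
have := h1 J; have := h2 J; rewrite /= !ltnn !eqxx expr0 expr1 mul1r mulN1r.
set b2 := v2 ord0 J; set b1 := v1 ord0 J; set c := y ord0 J => l2 l1.
have D0 : 0 < b1 - b2 by lra.
pose a := (c - b2) / (b1 - b2).
have a0 : 0 <= a by rewrite divr_ge0//; lra.
have a1 : a <= 1 by rewrite ler_pdivrMr//; lra.
exists (a *: v1 + (1 - a) *: v2); first exact: cK.
move=> i; have := h1 i; have := h2 i.
rewrite ltnS [(i <= j)%N]leq_eqVlt -val_eqE/= !mxE.
have [iJ|iJ]/= := eqVneq (i : nat) j.
  have -> : i = J by apply/val_inj.
  rewrite -/b1 -/b2 -/c => _ _.
  by rewrite /a; field; rewrite gt_eqF.
case: ifP => _ => [-> ->|]; first by ring.
move=> l2' l1'; have := convex_comb_gt0 a0 a1 l1' l2'.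
by case: (s i); rewrite ?expr0 ?expr1; lra.
Qed.

(** A small push of [x] into any orthant stays in the hull. Splitting off [x] from the pushed point
    leaves a point [u] of the remaining hull with [u - x] a positive multiple of the push, so the
    remaining hull meets every orthant at [x]. In dimension 0 this fails: a single point is interior
    to its own hull. *)
Lemma conv_hull_D1 (R : realType) (d : nat) (S : {fset 'rV[R]_d})
    (x : 'rV[R]_d) : (0 < d)%N -> (conv_hull S)^° x ->
  conv_hull (S `\ x)%fset = conv_hull S.
Proof.
move=> d0 Sx; apply/seteqP; split.
  by apply: conv_hull_mono => p; rewrite !inE => /andP[].
have [xS|xS] := boolP (x \in S); last by rewrite mem_fsetD1.
have xD : x \notin (S `\ x)%fset by rewrite !inE eqxx.
suff Dx : conv_hull (S `\ x)%fset x.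
  apply: conv_hull_min => [|p pS]; first exact: conv_hull_convex.
  have [->//|px] := eqVneq p x.
  by apply: conv_hull_self; rewrite !inE px.
apply: convex_stable_orthants => [|s]; first exact: conv_hull_convex.
have /nbhs_ballP[e /= e0 eS] : nbhs x (conv_hull S) by exact: Sx.
pose y := x + \row_i ((-1) ^+ s i * (e / 2)).
have /eS : ball x e y.
  apply/rV_ballP => // i; rewrite !mxE.
  have -> : x ord0 i - (x ord0 i + (-1) ^+ s i * (e / 2)) =
            - ((-1) ^+ s i * (e / 2)) by ring.
  by rewrite normrN normrM normrX normrN1 expr1n mul1r gtr0_norm; lra.
rewrite -{1}(fsetD1K xS) => /(conv_hull_cons xD)[yx|].
  have /rowP/(_ (Ordinal d0)) := yx.
  rewrite !mxE; case: (s _); rewrite ?expr0 ?expr1; lra.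
move=> [a [u [a0 a1 Du yE]]]; exists u => // i.
have /rowP/(_ i) := yE; rewrite !mxE => h.
have {}h : (1 - a) * ((-1) ^+ s i * (u ord0 i - x ord0 i)) = e / 2.
  have -> : (1 - a) * ((-1) ^+ s i * (u ord0 i - x ord0 i)) =
    (-1) ^+ s i * ((a * x ord0 i + (1 - a) * u ord0 i) - x ord0 i) by ring.
  rewrite -h addrAC subrr add0r mulrA -expr2 -exprM mulnC exprM.
  by rewrite sqrrN expr1n expr1n mul1r.
have := divr_gt0 e0 (ltr0Sn R 1); rewrite -h pmulr_rgt0//; lra.
Qed.

(* A point of T lying in the interior of conv T is redundant, and remains
   redundant after other redundant points have been removed. *)
Lemma conv_hull_absorb (R : realType) (d : nat) (T T' : {fset 'rV[R]_d}) :
  (0 < d)%N -> {subset T <= T'} ->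
  (forall x, x \in T' -> x \notin T -> (conv_hull T')^° x) ->
  conv_hull T = conv_hull T'.
Proof.
move=> d0 TT' h.
suff H (X : {fset 'rV[R]_d}) : (forall x, x \in X -> (conv_hull T')^° x) ->
    conv_hull (T' `\` X)%fset = conv_hull T'.
  rewrite -(H (T' `\` T)%fset) => [|x]; last first.
    by rewrite !inE => /andP[xT xT']; exact: h.
  by rewrite fsetDK//; apply/fsubsetP.
elim/fset1U_rect: X => [_|x X xX IH Xh]; first by rewrite fsetD0.
have XE : conv_hull (T' `\` X)%fset = conv_hull T'.
  by apply: IH => p pX; apply: Xh; rewrite fset1Ur.
rewrite fsetUC -fsetDDl -XE; apply: conv_hull_D1 => //.
by rewrite XE; apply: Xh; rewrite fset1U1.
Qed.

(* Perturbing the vertices by less than e moves each of the 2^d witnesses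
   x +- 2e only within its orthant. *)
Lemma conv_hull_stable (R : realType) (d : nat) (S T : {fset 'rV[R]_d})
    (x : 'rV[R]_d) (e : R) : 0 < e ->
  ball x (4 * e) `<=` conv_hull S ->
  (forall p, p \in S -> exists2 q, q \in T &
     forall i, `|p ord0 i - q ord0 i| < e) ->
  ball x (e / 2) `<=` (conv_hull T)^°.
Proof.
move=> e0 xS ST.
have sub : ball x e `<=` conv_hull T.
  move=> y /rV_ballP xy.
  apply: convex_stable_orthants => [|s]; first exact: conv_hull_convex.
  pose v := y + \row_i ((-1) ^+ s i * (2 * e)).
  have [|v' Tv' vv'] := conv_hull_perturb ST (x := v).
    apply: xS; apply/rV_ballP => [|i]; first by rewrite mulr_gt0.
    have /ltr_normlP[h1 h2] := xy e0 i.
    rewrite !mxE ltr_norml; apply/andP.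
    by case: (s i); rewrite ?expr0 ?expr1; split; lra.
  exists v' => // i; have /ltr_normlP[] := vv' i; rewrite !mxE.
  by case: (s i); rewrite ?expr0 ?expr1; lra.
move=> y xy; apply/nbhs_ballP; exists (e / 2) => /=; first lra.
move=> z yz; apply: sub; rewrite (_ : e = e / 2 + e / 2); last by lra.
exact: ball_triangle xy yz.
Qed.

(** * The boundary of a convex hull *)

(** Adding [x] replaces the hull by the cone over it with apex [x], a continuous image of a compact
    product. The apex is listed separately because that image is empty when [S] is. *)
Lemma conv_hull_compact (R : realType) (d : nat) (S : {fset 'rV[R]_d}) :
  compact (conv_hull S).
Proof.
elim/fset1U_rect: S => [|x S xS IH]; first by rewrite conv_hull0; exact: compact0.
pose f (au : R * 'rV[R]_d) := au.1 *: x + (1 - au.1) *: au.2.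
have -> : conv_hull (x |` S)%fset =
    [set x] `|` f @` (`[0, 1]%classic `*` conv_hull S).
  apply/seteqP; split => y.
    move=> /(conv_hull_cons xS)[->|[a [u [a0 a1 Su ->]]]]; first by left.
    by right; exists (a, u) => //; split => //=; rewrite in_itv/= a0 ltW.
  have xU : conv_hull (x |` S)%fset x by apply: conv_hull_self; rewrite fset1U1.
  case=> [->//|[[a u] /= [+ Su] <-]].
  rewrite in_itv/= => /andP[a0 a1]; apply: conv_hull_convex => //.
  by apply: conv_hull_mono Su => p pS; rewrite fset1Ur.
apply: compactU; first exact: compact_set1.
apply: continuous_compact; last by apply: compact_setX => //; exact: segment_compact.
apply: continuous_subspaceT => -[a u].
apply: cvgD; apply: cvgZ.
- exact: cvg_fst.
- exact: cvg_cst.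
- by apply: cvgB; [exact: cvg_cst|exact: cvg_fst].
- exact: cvg_snd.
Qed.

Lemma conv_hull_closed (R : realType) (d : nat) (S : {fset 'rV[R]_d}) :
  closed (conv_hull S).
Proof.
by apply: compact_closed; [exact: norm_hausdorff|exact: conv_hull_compact].
Qed.

Lemma borelRd_open (R : realType) (d : nat) (A : set 'rV[R]_d) :
  open A -> measurable (A : set (borelRd R d)).
Proof. exact: sub_sigma_algebra. Qed.

Lemma borelRd_closed (R : realType) (d : nat) (A : set 'rV[R]_d) :
  closed A -> measurable (A : set (borelRd R d)).
Proof.
move=> cA; have := @measurableC _ (borelRd R d) (~` A).
rewrite setCK; apply; apply: borelRd_open; apply: closed_openC; exact cA.
Qed.

Lemma conv_hull_measurable (R : realType) (d : nat) (S : {fset 'rV[R]_d}) :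
  measurable (conv_hull S : set (borelRd R d)).
Proof. apply: borelRd_closed; exact (@conv_hull_closed R d S). Qed.

(** Covers are finite lists, so that those of the subcubes of a cube can be concatenated. *)
Definition covered (R : realType) (d : nat) (A : set 'rV[R]_d) (v : R) : Prop :=
  exists2 l : seq ('rV[R]_d * 'rV[R]_d),
    A `<=` [set x | exists2 b, b \in l & box b.1 b.2 x] &
    \sum_(b <- l) box_vol b.1 b.2 <= v.

Lemma covered_bigcup (R : realType) (d : nat) (J : finType)
    (A : J -> set 'rV[R]_d) (v : J -> R) :
  (forall j, covered (A j) (v j)) -> covered (\bigcup_j A j) (\sum_j v j).
Proof.
move=> /fin_all_exists2[l lA lv].
exists (flatten [seq l j | j <- enum J]).
  move=> x [j _ /lA[b bl bx]]; exists b => //.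
  by apply/flattenP; exists (l j) => //; apply: map_f; rewrite mem_enum.
by rewrite big_flatten/= big_map big_enum/=; apply: ler_sum => j _.
Qed.

Definition cube (R : realType) (d : nat) (c : 'rV[R]_d) (s : R) : set 'rV[R]_d :=
  box c (c + const_mx s).

Lemma cubeP (R : realType) (d : nat) (c : 'rV[R]_d) (s : R) (x : 'rV[R]_d) :
  cube c s x <-> forall i, c ord0 i <= x ord0 i <= c ord0 i + s.
Proof. by split=> h i; have := h i; rewrite !mxE. Qed.

Lemma box_vol_cube (R : realType) (d : nat) (c : 'rV[R]_d) (s : R) : 0 <= s ->
  box_vol c (c + const_mx s) = s ^+ d.
Proof.
move=> s0; rewrite /box_vol; under eq_bigr => i _.
  rewrite !mxE addrAC subrr add0r max_l//; over.
by rewrite prodr_const card_ord.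
Qed.

Definition subcube_corner (R : realType) (d : nat) (c : 'rV[R]_d) (s : R)
  (j : 'I_d -> 'I_5) : 'rV[R]_d := c + \row_i ((j i)%:R * (s / 5)).

Lemma cube_subdivide (R : realType) (d : nat) (c : 'rV[R]_d) (s : R) :
  cube c s `<=`
  \bigcup_(j : {ffun 'I_d -> 'I_5}) cube (subcube_corner c s j) (s / 5).
Proof.
move=> x /cubeP cx.
have /fin_all_exists[j jx] i : exists j : 'I_5,
    j%:R * (s / 5) <= x ord0 i - c ord0 i <= j%:R * (s / 5) + s / 5.
  have /andP[h1 h2] := cx i.
  have [?|?] := leP (x ord0 i - c ord0 i) (s / 5).
    by exists (@Ordinal 5 0 isT) => /=; lra.
  have [?|?] := leP (x ord0 i - c ord0 i) (2 * (s / 5)).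
    by exists (@Ordinal 5 1 isT) => /=; lra.
  have [?|?] := leP (x ord0 i - c ord0 i) (3 * (s / 5)).
    by exists (@Ordinal 5 2 isT) => /=; lra.
  have [?|?] := leP (x ord0 i - c ord0 i) (4 * (s / 5)).
    by exists (@Ordinal 5 3 isT) => /=; lra.
  by exists (@Ordinal 5 4 isT) => /=; lra.
exists [ffun i => j i] => //; apply/cubeP => i.
by rewrite !mxE ffunE; have /andP[] := jx i; lra.
Qed.

(* If K misses none of the 2^d corner cubes of the 5^d-subdivision, then
   convexity forces the central one into the interior of K. *)
Lemma convex_boundary_miss (R : realType) (d : nat) (K : set 'rV[R]_d)
    (c : 'rV[R]_d) (s : R) : convex_stable K -> 0 < s ->
  exists j : {ffun 'I_d -> 'I_5},
    (K `\` K^°) `&` cube (subcube_corner c s j) (s / 5) = set0.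
Proof.
move=> cK s0.
pose corner (b : 'I_d -> bool) : {ffun 'I_d -> 'I_5} :=
  [ffun i => if b i then ord0 else ord_max].
have [[b Kb]|hit] := pselect (exists b,
    K `&` cube (subcube_corner c s (corner b)) (s / 5) = set0).
  exists (corner b); rewrite -subset0 -Kb => x [[Kx _] cx]; by split.
(* With five pieces per edge, one layer separates the central cube from the corner cubes. A ball of
   radius [s / 5] around a central point therefore stays, in each coordinate, strictly between the
   corner cubes. *)
exists [ffun=> @Ordinal 5 2 isT]; rewrite -subset0 => x [[Kx +] /cubeP cx].
apply; apply/nbhs_ballP; exists (s / 5) => /=; first lra.
move=> y /rV_ballP xy; apply: convex_stable_orthants => // b.
have [v [Kv /cubeP vc]] : K `&` cube (subcube_corner c s (corner b)) (s / 5) !=set0.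
  by apply/set0P/eqP => h'; apply: hit; exists b.
exists v => // i.
have s5 : 0 < s / 5 by lra.
have /ltr_normlP[] := xy s5 i; have /andP[] := vc i; have /andP[] := cx i.
rewrite !mxE !ffunE/=.
by case: (b i); rewrite ?expr0 ?expr1 /=; lra.
Qed.

(** Each subdivision drops one of the [5 ^ d] equal subcubes, which multiplies the volume still to
    be covered by [1 - 5^-1 ^+ d]. *)
Lemma convex_boundary_covered (R : realType) (d : nat) (K : set 'rV[R]_d)
    (n : nat) (c : 'rV[R]_d) (s : R) : convex_stable K -> 0 < s ->
  covered ((K `\` K^°) `&` cube c s) ((1 - 5^-1 ^+ d) ^+ n * s ^+ d).
Proof.
move=> cK; elim: n c s => [c s s0|n IH c s s0].
  exists [:: (c, c + const_mx s)].
    by move=> x [_ cx]; exists (c, c + const_mx s); rewrite ?inE.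
  by rewrite big_seq1/= (box_vol_cube c (ltW s0)) expr0 mul1r lexx.
have [j0 j0E] := convex_boundary_miss c cK s0.
have s5 : 0 < s / 5 by rewrite divr_gt0.
pose v (j : {ffun 'I_d -> 'I_5}) :=
  if j == j0 then 0 else (1 - 5^-1 ^+ d) ^+ n * (s / 5) ^+ d : R.
have /covered_bigcup[l lA lv] (j : {ffun _ -> _}) :
    covered ((K `\` K^°) `&` cube (subcube_corner c s j) (s / 5)) (v j).
  rewrite /v; case: eqP => [->|_]; last exact: IH.
  by rewrite j0E; exists [::] => //; rewrite big_nil.
exists l.
  move=> x [Kx /cube_subdivide[j _ jx]]; apply: lA.
  by exists j.
apply: (le_trans lv); rewrite (bigD1 j0)//= {1}/v eqxx add0r.
rewrite (eq_bigr (fun=> (1 - 5^-1 ^+ d) ^+ n * (s / 5) ^+ d)); last first.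
  by move=> j /negbTE jj0; rewrite /v jj0.
rewrite sumr_const exprS; have -> : #|[pred j | j != j0]| = (5 ^ d - 1)%N.
  have := cardC (pred1 j0); rewrite card1 card_ffun !card_ord => <-.
  by rewrite addnC addnK.
rewrite -[_ *+ (5 ^ d - 1)]mulr_natr natrB ?expn_gt0// natrX exprMn.
have h : 5^-1 ^+ d * 5 ^+ d = 1 :> R by rewrite -exprMn mulVf// expr1n.
set q := (1 - _) ^+ n; set z := 5^-1 ^+ d in h *.
rewrite le_eqVlt; apply/orP; left; apply/eqP.
have -> : q * (s ^+ d * z) * (5 ^+ d - 1) = q * s ^+ d * (z * 5 ^+ d - z) by ring.
by rewrite h; ring.
Qed.

Lemma covered_lebesgue_null (R : realType) (d : nat) (A : set 'rV[R]_d) :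
  (0 < d)%N -> (forall e, 0 < e -> covered A e) -> lebesgue_null A.
Proof.
move=> d0 cA e e0.
have [l lA lv] := cA (e / 2) (divr_gt0 e0 (ltr0Sn R 1)).
(* Past the end of the list the default is the degenerate box at the origin. Its volume is 0 because
   [0 < d]; an empty product would be 1. *)
pose b n := nth (0, 0) l n.
exists (fun n => (b n).1), (fun n => (b n).2); split.
  move=> x /lA[p pl px]; exists (index p l) => //.
  by rewrite /b nth_index.
have vol0 (p q : 'rV[R]_d) : 0 <= box_vol p q.
  by apply: prodr_ge0 => i _; rewrite le_max lexx orbT.
rewrite (nneseries_split 0 (size l)) => [|n _]; last by rewrite lee_fin.
rewrite add0n eseries0 => [|n + _]; last first.
  move=> ln; rewrite /b nth_default// /box_vol (bigD1 (Ordinal d0))//= subrr.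
  by rewrite maxxx mul0r.
rewrite adde0 sumEFin lte_fin.
move: lv; rewrite (big_nth (0, 0)) => /le_lt_trans; apply; lra.
Qed.

Lemma conv_hull_boundary_null (R : realType) (d : nat) (S : {fset 'rV[R]_d}) :
  (0 < d)%N -> lebesgue_null (conv_hull S `\` (conv_hull S)^°).
Proof.
move=> d0; apply: covered_lebesgue_null => // e e0.
have [M [_ /(_ (`|M| + 1))MS]] := compact_bounded (@conv_hull_compact R d S).
have {}MS x : conv_hull S x -> `|x| <= `|M| + 1.
  by move=> Sx; apply: MS => //; rewrite ltr_pwDr ?ler_norm.
(* The norms are at most one more than the absolute value of [M]; a further unit gives the strict
   bound required by the open ball. *)
pose L := `|M| + 2.
have L0 : 0 < L by rewrite /L ltr_wpDl.
pose s := 2 * L; have s0 : 0 < s by rewrite mulr_gt0.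
have Ssub : conv_hull S `<=` cube (const_mx (- L)) s.
  move=> x /MS xM; have : ball 0 L x.
    by rewrite -ball_normE /= sub0r normrN (le_lt_trans xM)// ltrD2l; lra.
  move=> /(rV_ballP _ _ L0) xL; apply/cubeP => i.
  by have /ltr_normlP[] := xL i; rewrite !mxE /s; lra.
pose z : R := 1 - 5^-1 ^+ d.
have z0 : 0 <= z by rewrite subr_ge0 exprn_ile1//; lra.
have z1 : z < 1 by rewrite ltrBlDr ltrDl exprn_gt0//; lra.
have [n zn] : exists n, z ^+ n * s ^+ d < e.
  have zc : z ^+ n @[n --> \oo] --> 0 by apply: cvg_expr; rewrite ger0_norm.
  have sd0 : 0 < s ^+ d by rewrite exprn_gt0.
  have /cvgrPdist_lt/(_ (e / s ^+ d) (divr_gt0 e0 sd0))[n _ /(_ n (leqnn n))] := zc.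
  rewrite sub0r normrN ger0_norm ?exprn_ge0// => h.
  by exists n; rewrite -ltr_pdivlMr.
have [l lA lv] := @convex_boundary_covered R d (conv_hull S) n
  (const_mx (- L)) s (@conv_hull_convex _ _ S) s0.
exists l; last exact: le_trans lv (ltW zn).
by move=> x Kx; apply: lA; split => //; apply: Ssub; case: Kx.
Qed.

(** This is where absolute continuity enters: the hull minus its interior is Lebesgue null. *)
Lemma conv_hull_interior_measure (R : realType) (d : nat)
    (mu : probability (borelRd R d) R) (S : {fset 'rV[R]_d}) :
  (0 < d)%N -> abs_cont_lebesgue mu ->
  mu (conv_hull S)^° = mu (conv_hull S).
Proof.
move=> d0 hmu; have mS := conv_hull_measurable S.
have mI : measurable ((conv_hull S)^° : set (borelRd R d)).
  by apply: borelRd_open; exact: open_interior.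
rewrite -{2}(setDKU (@interior_subset _ (conv_hull S))).
rewrite measureU//; last 2 first.
- exact: measurableD.
- by rewrite -subset0 => x [[]].
rewrite [X in (X + _)%E]hmu ?add0e//; last exact: conv_hull_boundary_null.
exact: measurableD.
Qed.

(** * Poisson variables *)

Lemma poisson_mass_ge0 (R : realType) (l : R) (n : nat) :
  0 <= l -> 0 <= poisson_mass l n.
Proof. by move=> l0; rewrite /poisson_mass !mulr_ge0 ?expR_ge0 ?exprn_ge0. Qed.

Lemma poisson_mass_sum (R : realType) (l : R) : 0 <= l ->
  (\sum_(0 <= n <oo) (poisson_mass l n)%:E = 1)%E.
Proof.
move=> l0; rewrite [RHS](_ : _ = (expR (- l))%:E * (expR l)%:E)%E; last first.
  by rewrite -EFinM expRN mulVf ?gt_eqF ?expR_gt0.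
under eq_eseriesr do rewrite /poisson_mass -mulrA EFinM.
rewrite nneseriesZl => [|n _]; last by rewrite lee_fin divr_ge0 ?exprn_ge0.
congr (_ * _)%E; rewrite expRE -EFin_lim; last first.
  rewrite /pseries/=; under eq_fun do rewrite mulrC.
  exact: is_cvg_series_exp_coeff.
apply/congr_lim/funext => n/=; rewrite /pseries/= /series/= -sumEFin//.
by under eq_bigr do rewrite mulrC.
Qed.

(** The terms below [k] vanish, and after a shift by [k] the falling factorial cancels against the
    factorial in the mass, leaving [l ^+ k] times the total mass. *)
Lemma poisson_factorial_moment (R : realType) (l : R) (k : nat) : 0 <= l ->
  (\sum_(0 <= n <oo) ((n ^_ k)%:R * poisson_mass l n)%:E = (l ^+ k)%:E)%E.
Proof.
move=> l0.
have f0 n : (0%E <= ((n ^_ k)%:R * poisson_mass l n)%:E)%E.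
  by rewrite lee_fin mulr_ge0 ?poisson_mass_ge0.
rewrite (nneseries_split 0 k)// add0n big_nat_cond big1 ?add0e; last first.
  by move=> n /andP[/andP[_ nk] _]; rewrite ffact_small// mul0r.
rewrite -nneseries_addn//.
have E n : ((n + k) ^_ k)%:R * poisson_mass l (n + k) =
    l ^+ k * poisson_mass l n.
  have nf : n`!%:R != 0 :> R by rewrite pnatr_eq0 -lt0n fact_gt0.
  have fE : ((n + k)`!)%:R = ((n + k) ^_ k)%:R * (n`!)%:R :> R.
    by rewrite -natrM -(ffact_fact (leq_addl n k)) addnK.
  have kf : ((n + k) ^_ k)%:R != 0 :> R.
    by rewrite pnatr_eq0 -lt0n ffact_gt0 leq_addl.
  by rewrite /poisson_mass fE exprD; field; rewrite kf nf.
under eq_eseriesr do rewrite E EFinM.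
rewrite nneseriesZl => [|n _]; last by rewrite lee_fin poisson_mass_ge0.
by rewrite poisson_mass_sum// mule1.
Qed.

(** * Integration over countable and finite partitions *)

Lemma integral_comp_nat (R : realType) (dO : measure_display)
    (T : measurableType dO) (P : {measure set T -> \bar R}) (E : set T)
    (X : T -> nat) (f : nat -> R) :
  measurable E -> measurable_fun setT X -> (forall n, 0 <= f n) ->
  (\int[P]_(w in E) (f (X w))%:E =
   \sum_(0 <= n <oo) (f n)%:E * P (E `&` X @^-1` [set n]))%E.
Proof.
move=> mE mX f0.
pose F n := E `&` X @^-1` [set n].
have mF n : measurable (F n).
  apply: measurableI => //.
  by rewrite -[_ @^-1` _]setTI; exact: mX.
have EE : E = \bigcup_n F n.
  by apply/seteqP; split => [w Ew|w [n _ []]//]; exists (X w).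
rewrite [in LHS]EE ge0_integral_bigcup//.
- apply: eq_eseriesr => n _.
  rewrite (eq_integral (cst (f n)%:E)) ?integral_cst// => w.
  by rewrite inE => -[_ /= ->].
- apply: measurable_funTS; apply/measurable_EFinP.
  exact: (measurableT_comp (f := f)).
- by move=> w _; rewrite lee_fin.
- apply/trivIsetP => i j _ _ ij; rewrite -subset0 => w [[_ wi] [_ wj]].
  by move: ij; rewrite -wi -wj eqxx.
Qed.

Section FiniteSelection.
Variables (R : realType) (dO : measure_display) (T : measurableType dO).
Variables (J : finType) (c : T -> J) (g : J -> T -> \bar R).
Hypothesis mc : forall j, measurable (c @^-1` [set j]).
Hypothesis mg : forall j, measurable_fun setT (g j).
Hypothesis g0 : forall j w, (0 <= g j w)%E.

Let selectE w : g (c w) w = (\sum_j (g j \_ (c @^-1` [set j])) w)%E.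
Proof.
rewrite (bigD1 (c w))//= patchE mem_set// big1 ?adde0// => j jc.
by rewrite patchE memNset//= => /eqP; rewrite eq_sym (negbTE jc).
Qed.

Let mpatch j : measurable_fun setT (g j \_ (c @^-1` [set j])).
Proof.
by apply: (measurable_restrictT _ (mc j)).1; exact: measurable_funTS.
Qed.

Lemma measurable_select : measurable_fun setT (fun w => g (c w) w).
Proof. by under eq_fun do rewrite selectE; exact: emeasurable_sum. Qed.

Lemma ge0_integral_select (P : {measure set T -> \bar R}) :
  (\int[P]_w g (c w) w = \sum_j \int[P]_(w in c @^-1` [set j]) g j w)%E.
Proof.
under eq_integral do rewrite selectE.
rewrite ge0_integral_sum//; last first.
  by move=> j w _; rewrite patchE; case: ifP.
by apply: eq_bigr => j _; rewrite [RHS]integral_mkcond.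
Qed.

End FiniteSelection.

(** * The core of a set of occupied cells *)

Section Core.
Variables (Z : finType) (Phi : {set Z} -> {set Z}).
Hypothesis Phi_mono : forall G O : {set Z}, G \subset O -> Phi G \subset Phi O.
Hypothesis Phi_absorb : forall G A : {set Z},
  A \subset Phi (G :|: A) -> Phi (G :|: A) \subset Phi G.

(** [Phi O] stands for the cells guaranteed to lie inside the hull when the cells of [O] are
    occupied. By [Phi_absorb], occupying cells that end up guaranteed guarantees nothing new. *)
Definition core (O : {set Z}) : {set Z} := O :\: Phi O.

Lemma core_Phi (O : {set Z}) : Phi (core O) = Phi O.
Proof.
apply/eqP; rewrite finset.eqEsubset Phi_mono ?finset.subsetDl//=.
have OE : O = core O :|: (O :&: Phi O) by rewrite /core finset.setUC finset.setID.
by rewrite {1}OE; apply: Phi_absorb; rewrite -OE finset.subsetIr.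
Qed.

(** The stopping property: whether the core is [G] is decided by the occupancy of cells outside
    [Phi G]. Under the right-hand side, [O] is [G] together with cells of [Phi G], and these are
    absorbed. *)
Lemma core_eqP (O G : {set Z}) : core O = G <->
  (forall z, z \in G -> z \notin Phi G) /\
  (forall z, z \notin Phi G -> (z \in O) = (z \in G)).
Proof.
split=> [<-|[GP OG]].
  by rewrite core_Phi; split => z => [|zP]; rewrite !inE ?zP// => /andP[].
have GO : G \subset O.
  by apply/fintype.subsetP => z zG; rewrite OG ?GP.
have PE : Phi O = Phi G.
  apply/eqP; rewrite finset.eqEsubset (Phi_mono GO) andbT.
  have OE : O = G :|: (O :&: Phi G).
    apply/setP => z; rewrite !inE; have [zP|zP] := boolP (z \in Phi G).
      rewrite andbT; case: (boolP (z \in G)) => //= zG.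
      by rewrite (fintype.subsetP GO).
    by rewrite andbF orbF OG.
  rewrite {1}OE; apply: Phi_absorb; rewrite -OE.
  by apply: fintype.subset_trans (Phi_mono GO); exact: finset.subsetIr.
apply/setP => z; rewrite !inE PE.
case: (boolP (z \in Phi G)) => zP /=; last by rewrite OG.
by apply/esym/negbTE/negP => /GP; rewrite zP.
Qed.

End Core.

(** * Poisson processes on regions determined from outside *)

Definition occupied (R : realType) (d : nat) (Z : finType)
    (cell : 'rV[R]_d -> Z) (S : {fset 'rV[R]_d}) : {set Z} :=
  finset (fun z => z \in [seq cell p | p <- S]).

Lemma mem_occupied (R : realType) (d : nat) (Z : finType)
    (cell : 'rV[R]_d -> Z) (S : {fset 'rV[R]_d}) (z : Z) :
  (z \in occupied cell S) = (0 < count_in S (cell @^-1` [set z]))%N.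
Proof.
rewrite inE /count_in cardfs_gt0; apply/mapP/fset0Pn => [[p pS ->]|[p]].
  by exists p; rewrite !inE pS mem_set.
by rewrite !inE => /andP[pS]; rewrite inE => /= <-; exists p.
Qed.

Section PoissonStopping.
Variables (R : realType) (d : nat) (mu : probability (borelRd R d) R) (t : R).
Variables (dO : measure_display) (Omega : measurableType dO).
Variables (P : probability Omega R) (eta : Omega -> {fset 'rV[R]_d}).
Hypothesis t0 : 0 <= t.
Hypothesis heta : poisson_point_process P (fun A => t%:E * mu A)%E eta.
Variables (Z : finType) (cell : 'rV[R]_d -> Z) (Phi : {set Z} -> {set Z}).
Hypothesis mcell :
  forall z, measurable (cell @^-1` [set z] : set (borelRd R d)).
Hypothesis Phi_mono : forall G O : {set Z}, G \subset O -> Phi G \subset Phi O.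
Hypothesis Phi_absorb : forall G A : {set Z},
  A \subset Phi (G :|: A) -> Phi (G :|: A) \subset Phi G.

Definition cells_of (O : {set Z}) : set 'rV[R]_d := [set x | cell x \in O].

Let V (G : {set Z}) : set 'rV[R]_d := cells_of (Phi G).
Let c (w : Omega) : {set Z} := core Phi (occupied cell (eta w)).

Let coreP (w : Omega) (G : {set Z}) : c w = G <->
  (forall z, z \in G -> z \notin Phi G) /\
  (forall z, z \notin Phi G -> (z \in occupied cell (eta w)) = (z \in G)).
Proof. exact: core_eqP. Qed.

Let occupied_region (w : Omega) :
  cells_of (Phi (occupied cell (eta w))) = V (c w).
Proof. by rewrite /V core_Phi. Qed.

Lemma cells_of_measurable (O : {set Z}) :
  measurable (cells_of O : set (borelRd R d)).
Proof.
have -> : cells_of O = \bigcup_(z in [set z | z \in O]) (cell @^-1` [set z]).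
  apply/seteqP; split => [x xO|x [z zO xz]]; first by exists (cell x).
  by rewrite /cells_of /= (xz : cell x = z); exact: zO.
by apply: fin_bigcup_measurable => // z _; exact: mcell.
Qed.

Let count_measurable (A : set 'rV[R]_d) (B : set nat) :
  measurable (A : set (borelRd R d)) ->
  measurable [set w | B (count_in (eta w) A)].
Proof.
move=> mA; case: heta => /(_ A mA) mf _ _.
rewrite (_ : [set w | _] = setT `&` (fun w => count_in (eta w) A) @^-1` B).
  exact: mf.
by rewrite setTI.
Qed.

(** The disjoint family fed to the independence axiom: index 0 is the region [V G], and the other
    indices enumerate the cells. Cells already inside [V G] are replaced by the empty set, with a
    void condition in [cond]. *)
Let piece (G : {set Z}) (i : 'I_#|Z|.+1) : set 'rV[R]_d :=
  if unlift ord0 i is Some j then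
    if enum_val j \in Phi G then set0 else cell @^-1` [set enum_val j]
  else V G.

Let cond (G : {set Z}) (B0 : set nat) (i : 'I_#|Z|.+1) : set nat :=
  if unlift ord0 i is Some j then
    if enum_val j \in Phi G then setT
    else [set n | (0 < n)%N = (enum_val j \in G)]
  else B0.

Let piece_measurable G i : measurable (piece G i : set (borelRd R d)).
Proof.
rewrite /piece; case: unlift => [j|]; last exact: cells_of_measurable.
by case: ifP => _ //; exact: mcell.
Qed.

Let piece_disjoint G i j : i != j -> piece G i `&` piece G j = set0.
Proof.
rewrite /piece => ij; rewrite -subset0 => x.
case: (unliftP ord0 i) ij => [i' ->|->]; case: (unliftP ord0 j) => [j' ->|->].
- rewrite (inj_eq lift_inj) => /negP ij []; case: ifP => [_ []|_ xi].
  case: ifP => [_ []|_ xj]; apply: ij; apply/eqP/enum_val_inj.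
  by rewrite -(xi : cell x = _) -(xj : cell x = _).
- move=> _ []; case: ifP => [_ []|iP xi].
  by rewrite /V /cells_of /= (xi : cell x = _) iP.
- move=> _ [Vx]; case: ifP => [_ []|jP xj].
  by move: Vx; rewrite /V /cells_of /= (xj : cell x = _) jP.
- by rewrite eqxx.
Qed.

(** By [core_eqP], fixing the core prescribes the occupancy of each cell outside [V G], which is a
    condition on the counts of the pieces of nonzero index. *)
Let core_event (G : {set Z}) (B0 : set nat) : (forall z, z \in G -> z \notin Phi G) ->
  c @^-1` [set G] `&` [set w | B0 (count_in (eta w) (V G))] =
  \bigcap_(i in [set: 'I_#|Z|.+1])
    [set w | cond G B0 i (count_in (eta w) (piece G i))].
Proof.
move=> GP; apply/seteqP; split => w.
  move=> [/= /coreP[_ OG] B0w] i _ /=; rewrite /cond /piece.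
  case: unlift => // j; case: ifP => // /negbT jP.
  by rewrite /= -mem_occupied OG.
move=> H; split; last by have /= := H ord0 I; rewrite /cond /piece unlift_none.
apply/coreP; split => // z zP.
have /= := H (lift ord0 (enum_rank z)) I.
by rewrite /cond /piece liftK enum_rankK (negbTE zP) /= mem_occupied.
Qed.

Let core_measurable G : measurable (c @^-1` [set G]).
Proof.
have [GP|GP] := pselect (forall z, z \in G -> z \notin Phi G); last first.
  rewrite (_ : _ @^-1` _ = set0)// -subset0 => w /= /coreP[GP' _].
  exact: GP.
have := core_event setT GP.
rewrite (_ : [set w | _] = setT) ?setIT => [->|]; last first.
  by apply/seteqP; split.
by apply: fin_bigcap_measurable => // i _; apply: count_measurable; exact: piece_measurable.
Qed.

(* The event that the core is G concerns only cells outside V G. *)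
Let core_indep G n :
  P (c @^-1` [set G] `&` [set w | count_in (eta w) (V G) = n]) =
  (P (c @^-1` [set G]) * P [set w | count_in (eta w) (V G) = n])%E.
Proof.
have [GP|GP] := pselect (forall z, z \in G -> z \notin Phi G); last first.
  rewrite (_ : _ @^-1` _ = set0) ?set0I ?measure0 ?mul0e// -subset0.
  by move=> w /= /coreP[GP' _]; apply: GP.
pose Q := (\prod_(j < #|Z|) P [set w | cond G setT (lift ord0 j)
  (count_in (eta w) (piece G (lift ord0 j)))])%E.
have prodE (B0 : set nat) :
    P (c @^-1` [set G] `&` [set w | B0 (count_in (eta w) (V G))]) =
    (P [set w | B0 (count_in (eta w) (V G))] * Q)%E.
  rewrite core_event//; case: heta => _ _ indep.
  rewrite indep; [|exact: piece_measurable|exact: piece_disjoint].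
  rewrite big_ord_recl /cond /piece unlift_none; congr (_ * _)%E.
  by rewrite /Q /cond /piece; apply: eq_bigr => j _; rewrite liftK.
have ST : [set w | [set: nat] (count_in (eta w) (V G))] = [set: Omega] by [].
(* With no condition on the count in [V G], the product formula identifies [Q] as the probability
   that the core is [G]. *)
have := prodE setT; rewrite ST setIT probability_setT mul1e => ->.
by rewrite (prodE [set n]) muleC.
Qed.

Let core_moment G k :
  (\int[P]_(w in c @^-1` [set G]) (((count_in (eta w) (V G)) ^_ k)%:R : R)%:E =
   P (c @^-1` [set G]) * (t ^+ k * fine (mu (V G)) ^+ k)%:E)%E.
Proof.
have mV : measurable (V G : set (borelRd R d)) := cells_of_measurable (Phi G).
case: (heta) => mX /(_ (V G) mV)[_ pX] _.
have f0 n : 0 <= (n ^_ k)%:R :> R by exact: ler0n.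
rewrite (integral_comp_nat P (core_measurable G) (mX _ mV) f0).
have l0 : 0 <= fine (t%:E * mu (V G)) by rewrite fine_ge0// mule_ge0.
rewrite -exprMn -[t * _]/(fine t%:E * _) -fineM ?fin_num_measure//.
rewrite -poisson_factorial_moment//.
have PE : P (c @^-1` [set G]) \is a fin_num by rewrite fin_num_measure.
rewrite -(fineK PE) -nneseriesZl => [|n _]; last first.
  by rewrite lee_fin mulr_ge0 ?poisson_mass_ge0.
apply: eq_eseriesr => n _.
rewrite [X in (_ * P X)%E](_ : _ =
  c @^-1` [set G] `&` [set w | count_in (eta w) (V G) = n])//.
by rewrite core_indep pX EFinM muleCA fineK.
Qed.

Lemma stopped_count_measurable k : measurable_fun setT (fun w =>
  (((count_in (eta w) (cells_of (Phi (occupied cell (eta w))))) ^_ k)%:R : R)%:E).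
Proof.
under eq_fun do rewrite occupied_region.
apply: (measurable_select (c := c)
  (g := fun G w => (((count_in (eta w) (V G)) ^_ k)%:R : R)%:E)) => // G.
apply/measurable_EFinP.
apply: (measurableT_comp (f := fun n : nat => (n ^_ k)%:R : R)) => //.
by case: heta => mX _ _; apply: mX; exact: cells_of_measurable.
Qed.

Lemma stopped_measure_measurable k : measurable_fun setT (fun w =>
  ((fine (mu (cells_of (Phi (occupied cell (eta w)))))) ^+ k)%:E).
Proof.
under eq_fun do rewrite occupied_region.
by apply: (measurable_select (c := c)
  (g := fun G w => ((fine (mu (V G))) ^+ k)%:E)).
Qed.

Lemma stopped_factorial_moment k :
  (\int[P]_w (((count_in (eta w) (cells_of (Phi (occupied cell (eta w))))) ^_ k)%:R
      : R)%:E =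
   (t ^+ k)%:E *
   \int[P]_w ((fine (mu (cells_of (Phi (occupied cell (eta w)))))) ^+ k)%:E)%E.
Proof.
under eq_integral do rewrite occupied_region.
under [X in (_ * X)%E]eq_integral do rewrite occupied_region.
have fV G : 0 <= fine (mu (V G)) by rewrite fine_ge0.
rewrite (ge0_integral_select (c := c)
  (g := fun G w => (((count_in (eta w) (V G)) ^_ k)%:R : R)%:E))//; last first.
  move=> G; apply/measurable_EFinP.
  apply: (measurableT_comp (f := fun n : nat => (n ^_ k)%:R : R)) => //.
  by case: heta => mX _ _; apply: mX; exact: cells_of_measurable.
rewrite (ge0_integral_select (c := c)
  (g := fun G w => ((fine (mu (V G))) ^+ k)%:E))//; last first.
  by move=> G w; rewrite lee_fin exprn_ge0.
rewrite ge0_sume_distrr => [|G _]; last first.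
  by apply: integral_ge0 => w _; rewrite lee_fin exprn_ge0.
apply: eq_bigr => G _.
by rewrite core_moment integral_cst// EFinM [LHS]muleC -muleA.
Qed.

End PoissonStopping.

(** * Inner approximations of a hull by cells *)

(** [T] ranges over all finite configurations that occupy at least the cells of [O]. Labels of empty
    cells are excluded, so that every certain cell has a representative point. *)
Definition hull_cells (R : realType) (d : nat) (Z : finType)
    (cell : 'rV[R]_d -> Z) (O : {set Z}) : {set Z} :=
  finset (fun z => `[< (exists x, cell x = z) /\
    forall T : {fset 'rV[R]_d},
      (forall a, a \in O -> exists2 q, q \in T & cell q = a) ->
      forall y, cell y = z -> (conv_hull T)^° y >]).

Lemma hull_cellsP (R : realType) (d : nat) (Z : finType)
    (cell : 'rV[R]_d -> Z) (O : {set Z}) (z : Z) :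
  reflect ((exists x, cell x = z) /\
    forall T : {fset 'rV[R]_d},
      (forall a, a \in O -> exists2 q, q \in T & cell q = a) ->
      forall y, cell y = z -> (conv_hull T)^° y) (z \in hull_cells cell O).
Proof. by rewrite finset.in_set; exact: asboolP. Qed.

Lemma hull_cells_mono (R : realType) (d : nat) (Z : finType)
    (cell : 'rV[R]_d -> Z) (G O : {set Z}) :
  G \subset O -> hull_cells cell G \subset hull_cells cell O.
Proof.
move=> /fintype.subsetP GO; apply/fintype.subsetP => z.
move=> /hull_cellsP[zx zG]; apply/hull_cellsP; split => // T TO.
by apply: zG => a /GO; exact: TO.
Qed.

(** Enlarge a configuration occupying [G] by one representative of each cell of [A]. The new points
    lie in the interior of the enlarged hull, so by [conv_hull_absorb] the hull has not changed. *)
Lemma hull_cells_absorb (R : realType) (d : nat) (Z : finType)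
    (cell : 'rV[R]_d -> Z) (G A : {set Z}) : (0 < d)%N ->
  A \subset hull_cells cell (G :|: A) ->
  hull_cells cell (G :|: A) \subset hull_cells cell G.
Proof.
move=> d0 /fintype.subsetP AGA; apply/fintype.subsetP => z.
move=> /hull_cellsP[zx zGA]; apply/hull_cellsP; split => // T TG.
pose r a := xget 0 [set x | cell x = a].
have rA a : a \in A -> cell (r a) = a.
  move=> /AGA/hull_cellsP[[x xa] _].
  exact: (xgetPex 0 (ex_intro [set x | cell x = a] x xa)).
pose T' := (T `|` [fset r a | a in A])%fset.
have T'GA a : a \in G :|: A -> exists2 q, q \in T' & cell q = a.
  rewrite finset.in_setU => /orP[/TG[q qT qa]|aA].
    by exists q; rewrite // in_fsetU qT.
  by exists (r a); [rewrite in_fsetU in_imfset ?orbT|exact: rA].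
rewrite (@conv_hull_absorb _ _ T T')//; first exact: zGA.
  by move=> p pT; rewrite in_fsetU pT.
move=> x; rewrite in_fsetU => /orP[->//|/imfsetP[a /= aA ->] _].
by have /hull_cellsP[_] := AGA _ aA; apply => //; exact: rA.
Qed.

(** * Cells cut out by rational half-spaces *)

(** One sequence enumerates the pairs of a coordinate and a rational threshold; numbers coding no
    pair give the empty set. Its first [m] terms cut out a finite partition that is refined as [m]
    grows. *)
Definition rational_halfspace (R : realType) (d : nat) (n : nat) :
    set 'rV[R]_d :=
  if choice.unpickle n is Some (i, q) then [set x | x ord0 i < ratr q] else set0.

Definition halfspace_cell (R : realType) (d m : nat) (x : 'rV[R]_d) :
    {ffun 'I_m -> bool} :=
  [ffun j : 'I_m => x \in @rational_halfspace R d j].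

Lemma halfspace_cellP (R : realType) (d m : nat) (x y : 'rV[R]_d) :
  halfspace_cell m x = halfspace_cell m y <->
  forall j, (j < m)%N ->
    (x \in @rational_halfspace R d j) = (y \in @rational_halfspace R d j).
Proof.
split=> [/ffunP xy j jm|xy]; first by have := xy (Ordinal jm); rewrite !ffunE.
by apply/ffunP => j; rewrite !ffunE xy.
Qed.

Lemma halfspace_cell_refine (R : realType) (d m n : nat) (x y : 'rV[R]_d) :
  (m <= n)%N -> halfspace_cell n x = halfspace_cell n y ->
  halfspace_cell m x = halfspace_cell m y.
Proof.
move=> mn /halfspace_cellP xy; apply/halfspace_cellP => j jm.
by apply: xy; exact: leq_trans mn.
Qed.

Lemma rational_halfspace_measurable (R : realType) (d n : nat) :
  measurable (@rational_halfspace R d n : set (borelRd R d)).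
Proof.
rewrite /rational_halfspace; case: choice.unpickle => [[i q]|]; last exact: measurable0.
apply: borelRd_open; apply: (open_comp (f := fun x : 'rV[R]_d => x ord0 i)
  (D := [set r | r < ratr q])); last exact: open_lt.
by move=> x _; exact: coord_continuous.
Qed.

Lemma halfspace_cell_measurable (R : realType) (d m : nat) z :
  measurable (@halfspace_cell R d m @^-1` [set z] : set (borelRd R d)).
Proof.
rewrite (_ : _ @^-1` _ = \bigcap_(j in [set: 'I_m])
    (if z j then @rational_halfspace R d j else ~` @rational_halfspace R d j)).
  apply: fin_bigcap_measurable => // j _.
  by case: ifP => _; [|apply: measurableC]; exact: rational_halfspace_measurable.
apply/seteqP; split => [x /= <- j _|x xz].
  by rewrite ffunE; case: ifPn => [|/negP]; rewrite inE.
apply/ffunP => j; rewrite ffunE; have := xz j I.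
by case: (z j) => xj; [exact: mem_set|exact: memNset].
Qed.

(** In each coordinate, [x] is enclosed by two rationals within [e]. Once both thresholds have been
    enumerated, every point in the cell of [x] lies between them. *)
Lemma halfspace_cell_shrink (R : realType) (d : nat) (x : 'rV[R]_d) (e : R) :
  0 < e -> exists m, forall n y, (m <= n)%N ->
    halfspace_cell n y = halfspace_cell n x ->
    forall i, `|x ord0 i - y ord0 i| < e.
Proof.
move=> e0.
have /fin_all_exists[k kP] i : exists k : nat, forall n y, (k <= n)%N ->
    halfspace_cell n y = halfspace_cell n x -> `|x ord0 i - y ord0 i| < e.
  have [a] : exists q : rat, ratr q \in `]x ord0 i - e, x ord0 i[.
    by apply: rat_in_itvoo; lra.
  have [b] : exists q : rat, ratr q \in `]x ord0 i, x ord0 i + e[.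
    by apply: rat_in_itvoo; lra.
  rewrite !in_itv/= => /andP[b1 b2] /andP[a1 a2].
  exists (maxn (choice.pickle (i, a)) (choice.pickle (i, b))).+1 => n y kn /halfspace_cellP xy.
  have := xy _ (leq_ltn_trans (leq_maxl _ _) kn).
  have := xy _ (leq_ltn_trans (leq_maxr _ _) kn).
  rewrite /rational_halfspace !choice.pickleK => hb ha.
  have yb : y ord0 i < ratr b.
    have : y \in [set x : 'rV[R]_d | x ord0 i < ratr b] by rewrite hb inE.
    by rewrite inE.
  have ya : ratr a <= y ord0 i.
    rewrite leNgt; apply/negP => ya.
    have : x \in [set x : 'rV[R]_d | x ord0 i < ratr a] by rewrite -ha inE.
    by rewrite inE /= => xa; lra.
  by rewrite ltr_norml; apply/andP; split; lra.
exists (\max_i k i)%N => n y kn xy i; apply: kP xy.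
by apply: leq_trans kn; exact: leq_bigmax.
Qed.

(** * Exhaustion of the interior of the hull *)

Section Exhaustion.
Variables (R : realType) (d : nat).
Implicit Types (S T : {fset 'rV[R]_d}) (x y : 'rV[R]_d) (m n : nat).

Definition inner_region m S : set 'rV[R]_d :=
  cells_of (@halfspace_cell R d m)
    (hull_cells (@halfspace_cell R d m) (occupied (@halfspace_cell R d m) S)).

Lemma inner_regionP m S x : inner_region m S x <->
  forall T, (forall p, p \in S -> exists2 q, q \in T &
               halfspace_cell m q = halfspace_cell m p) ->
  forall y, halfspace_cell m y = halfspace_cell m x -> (conv_hull T)^° y.
Proof.
split => [/hull_cellsP[_ h] T TS|h].
  by apply: h => a; rewrite finset.in_set => /mapP[p pS ->]; exact: TS.
apply/hull_cellsP; split; first by exists x.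
by move=> T TS; apply: h => p pS; apply: TS; rewrite finset.in_set map_f.
Qed.

Lemma inner_region_sub m S : inner_region m S `<=` (conv_hull S)^°.
Proof. by move=> x /inner_regionP; apply => // p pS; exists p. Qed.

Lemma inner_region_homo S : {homo inner_region^~ S : m n / (m <= n)%N >-> m `<=` n}.
Proof.
move=> m n mn x /inner_regionP h; apply/inner_regionP => T TS y yx.
apply: h; last exact: halfspace_cell_refine yx.
by move=> p /TS[q qT qp]; exists q => //; exact: halfspace_cell_refine qp.
Qed.

Lemma inner_region_exhaust S : \bigcup_m inner_region m S = (conv_hull S)^°.
Proof.
apply/seteqP; split => [x [m _]|x]; first exact: inner_region_sub.
move=> Sx; have /nbhs_ballP[e /= e0 eS] : nbhs x (conv_hull S) by exact: Sx.
(* [conv_hull_stable] needs a ball of radius [4 * f] inside the hull and covers the points within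
   [f / 2] of [x]. The level below is fine enough for the cell of [x] and for the cells of all
   points of [S]. *)
pose f := e / 4; have f0 : 0 < f by rewrite divr_gt0.
have f2 : 0 < f / 2 by rewrite divr_gt0.
have [k kP] := choice (fun p => @halfspace_cell_shrink R d p _ f2).
exists (maxn (k x) (\max_(p <- S) k p)%N) => //.
apply/inner_regionP => T TS y yx.
apply: (@conv_hull_stable _ _ S T x f) => //.
- by rewrite mulrCA divff ?mulr1.
- move=> p pS; have [q qT qp] := TS p pS; exists q => // i.
  apply: (@lt_trans _ _ (f / 2)); last by lra.
  apply: (kP p) qp i; apply: leq_trans (leq_maxr _ _).
  exact: leq_bigmax_seq.
- by apply/rV_ballP => // i; apply: (kP x) yx i; exact: leq_maxl.
Qed.

End Exhaustion.

(** * Passage to the limit *)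

Lemma leq_ffact (m n k : nat) : (m <= n)%N -> (m ^_ k <= n ^_ k)%N.
Proof.
elim: k m n => // k IH m n mn; rewrite !ffactnS leq_mul// IH//.
by rewrite -!subn1 leq_sub2r.
Qed.

Lemma count_in_mono (R : realType) (d : nat) (S : {fset 'rV[R]_d})
    (A B : set 'rV[R]_d) : A `<=` B -> (count_in S A <= count_in S B)%N.
Proof.
move=> AB; apply: fsubset_leq_card; apply/fsubsetP => x.
rewrite !in_fset /= !inE => /andP[-> ] /=; rewrite !inE; exact: AB.
Qed.

(** Membership of each point in the increasing sets stabilises, and there are only finitely many
    points. *)
Lemma count_in_cvg (R : realType) (d : nat) (S : {fset 'rV[R]_d})
    (A : nat -> set 'rV[R]_d) :
  {homo A : m n / (m <= n)%N >-> m `<=` n} ->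
  exists M, forall m, (M <= m)%N ->
    count_in S (A m) = count_in S (\bigcup_n A n).
Proof.
move=> homoA.
have /choice[k kP] p : exists k, forall m, (k <= m)%N ->
    (\bigcup_n A n) p -> A m p.
  have [[k _ Ak]|nA] := pselect ((\bigcup_n A n) p); last by exists 0%N.
  by exists k => m km _; exact: homoA km _ Ak.
exists (\max_(p <- S) k p)%N => m km; apply/eqP; rewrite eqn_leq.
rewrite count_in_mono/=; last by move=> x Ax; exists m.
apply: fsubset_leq_card; apply/fsubsetP => p; rewrite !inE /= => /andP[pS].
rewrite pS inE => pA; rewrite inE; apply: kP pA.
by apply: leq_trans km; exact: leq_bigmax_seq.
Qed.

Lemma ge0_integral_cvg (R : realType) (dO : measure_display)
    (T : measurableType dO) (P : {measure set T -> \bar R})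
    (f : nat -> T -> R) (g : T -> R) :
  (forall n, measurable_fun setT (fun w => (f n w)%:E)) ->
  (forall n w, 0 <= f n w) ->
  (forall w, {homo f^~ w : m n / (m <= n)%N >-> m <= n}) ->
  (forall w, f n w @[n --> \oo] --> g w) ->
  (\int[P]_w (f n w)%:E @[n --> \oo] --> \int[P]_w (g w)%:E)%E.
Proof.
move=> mf f0 nd fg.
rewrite (eq_integral (fun w => limn (fun n => (f n w)%:E))).
  apply: cvg_monotone_convergence => //.
  - by move=> n w _; rewrite lee_fin.
  - by move=> w _ m n mn; rewrite lee_fin nd.
move=> w _; apply/esym/cvg_lim => //.
by apply: cvg_EFin; [near=> n|exact: fg].
Unshelve. all: by end_near. Qed.


(** * The moment identity in positive dimension *)

Section Expectation.
Variables (R : realType) (d : nat) (mu : probability (borelRd R d) R).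
Hypothesis hmu : abs_cont_lebesgue mu.
Variables (t : R) (dO : measure_display) (Omega : measurableType dO).
Variables (P : probability Omega R) (eta : Omega -> {fset 'rV[R]_d}).
Hypothesis t0 : 0 <= t.
Hypothesis heta : poisson_point_process P (fun A => t%:E * mu A)%E eta.
Hypothesis d0 : (0 < d)%N.

Let region m w := inner_region m (eta w).

Let region_measurable m w : measurable (region m w : set (borelRd R d)).
Proof. by apply: cells_of_measurable; exact: halfspace_cell_measurable. Qed.

Let region_moment m k :
  (\int[P]_w (((count_in (eta w) (region m w)) ^_ k)%:R : R)%:E =
   (t ^+ k)%:E * \int[P]_w ((fine (mu (region m w))) ^+ k)%:E)%E.
Proof.
apply: stopped_factorial_moment => //.
- exact: halfspace_cell_measurable.
- by move=> G O; exact: hull_cells_mono.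
- by move=> G A; exact: hull_cells_absorb.
Qed.

Let region_count_measurable m k : measurable_fun setT (fun w =>
  (((count_in (eta w) (region m w)) ^_ k)%:R : R)%:E).
Proof.
apply: (stopped_count_measurable heta) => //.
- exact: halfspace_cell_measurable.
- by move=> G O; exact: hull_cells_mono.
- by move=> G A; exact: hull_cells_absorb.
Qed.

Let region_measure_measurable m k : measurable_fun setT (fun w =>
  ((fine (mu (region m w))) ^+ k)%:E).
Proof.
apply: (stopped_measure_measurable heta) => //.
- exact: halfspace_cell_measurable.
- by move=> G O; exact: hull_cells_mono.
- by move=> G A; exact: hull_cells_absorb.
Qed.

Let count_cvg k :
  (\int[P]_w (((count_in (eta w) (region m w)) ^_ k)%:R : R)%:E @[m --> \oo]
   --> \int[P]_w (((interior_count (eta w)) ^_ k)%:R : R)%:E)%E.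
Proof.
apply: ge0_integral_cvg => [m|m w|w m n mn|w].
- exact: region_count_measurable.
- exact: ler0n.
- rewrite ler_nat leq_ffact// count_in_mono//; exact: inner_region_homo.
apply: cvg_near_cst.
have [M MP] := count_in_cvg (eta w) (@inner_region_homo R d (eta w)).
exists M => // m /= Mm.
by rewrite /region MP// inner_region_exhaust.
Qed.

(** Continuity from below yields the measure of the interior, which equals that of the hull. *)
Let measure_cvg k :
  (\int[P]_w ((fine (mu (region m w))) ^+ k)%:E @[m --> \oo]
   --> \int[P]_w ((fine (mu (conv_hull (eta w)))) ^+ k)%:E)%E.
Proof.
apply: ge0_integral_cvg => [m|m w|w m n mn|w].
- exact: region_measure_measurable.
- by rewrite exprn_ge0// fine_ge0.
- apply: lerXn2r; rewrite ?nnegrE ?fine_ge0//.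
  apply: fine_le; rewrite ?fin_num_measure//.
  by apply: le_measure; rewrite ?inE//; exact: inner_region_homo.
suff fc : fine (mu (region m w)) @[m --> \oo] --> fine (mu (conv_hull (eta w))).
  exact: (continuous_cvg _ (@exprn_continuous R k _) fc).
apply: fine_cvg; rewrite fineK ?fin_num_measure//; last first.
  exact: conv_hull_measurable.
rewrite -conv_hull_interior_measure// -inner_region_exhaust.
apply: nondecreasing_cvg_mu => //.
- apply: (@bigcup_measurable _ (borelRd R d)) => m _.
  exact: region_measurable.
- by move=> m n mn; apply/subsetPset; exact: inner_region_homo.
Qed.

Lemma interior_count_factorial_moment k :
  (\int[P]_w (((interior_count (eta w)) ^_ k)%:R : R)%:E =
   (t ^+ k)%:E * \int[P]_w ((fine (mu (conv_hull (eta w)))) ^+ k)%:E)%E.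
Proof.
have h := cvgeZl (y := (t ^+ k)%:E) isT (@measure_cvg k).
rewrite -(cvg_lim _ h)// -(cvg_lim _ (@count_cvg k))//.
by apply/congr_lim/funext => m; exact: region_moment.
Qed.

End Expectation.

(** * Excluding dimension zero *)

Lemma count_in_rV0 (R : realType) (S : {fset 'rV[R]_0}) (A : set 'rV[R]_0) :
  (count_in S A < 2)%N.
Proof.
have sub : {subset [fset x in S | x \in A]%fset <= [fset (0 : 'rV[R]_0)]%fset}.
  by move=> x _; rewrite inE; apply/eqP/rowP => -[].
by rewrite ltnS -(cardfs1 (0 : 'rV[R]_0)); apply/fsubset_leq_card/fsubsetP.
Qed.

(* With only one point in R^0, a simple point process has at most one atom,
   whereas a Poisson variable of parameter t takes the value 2 as well. *)
Lemma poisson_point_process_dim_gt0 (R : realType) (d : nat)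
    (mu : probability (borelRd R d) R) (t : R) (dO : measure_display)
    (Omega : measurableType dO) (P : probability Omega R)
    (eta : Omega -> {fset 'rV[R]_d}) : 0 < t ->
  poisson_point_process P (fun A => t%:E * mu A)%E eta -> (0 < d)%N.
Proof.
case: d mu eta => // mu eta t0 [_ + _].
move=> /(_ setT measurableT)[_ /(_ 2%N)].
rewrite probability_setT mule1 (_ : [set w | _] = set0) ?measure0; last first.
  by rewrite -subset0 => w /= c2; have := count_in_rV0 (eta w) setT; rewrite c2.
move=> /eqP; rewrite eq_sym /poisson_mass /= eqe gt_eqF//.
by rewrite divr_gt0// mulr_gt0 ?expR_gt0 ?exprn_gt0.
Qed.

Unset Implicit Arguments.

Theorem theorem2 (R : realType) (d : nat)
  (mu : probability (borelRd R d) R)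
  (hmu : abs_cont_lebesgue mu)
  (t : R) (ht : 0 < t)
  (dO : measure_display) (Omega : measurableType dO) (P : probability Omega R)
  (eta : Omega -> {fset 'rV[R]_d})
  (heta : poisson_point_process P (fun A => t%:E * mu A)%E eta)
  (k : nat) :
  (\int[P]_w (((interior_count (eta w)) ^_ k)%:R : R)%:E =
   (t ^+ k)%:E * \int[P]_w ((fine (mu (conv_hull (eta w)))) ^+ k)%:E)%E.
Proof.
apply: interior_count_factorial_moment => //; first exact: ltW.
exact: poisson_point_process_dim_gt0 ht heta.
Qed.
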